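(* Let $0<\alpha<1$, $\nu>0$, $T>1$, let $G\subset\mathbb{R}^n$ be a bounded domain with smooth boundary $\partial G$, and put $\Omega=G\times(1,T]$. Let $F$ (on $\overline\Omega$), $\varphi$ (on $\bar G$) and $\psi$ (on $\partial G\times[1,T]$) be continuous, and let $u$ be a solution of $$D_{*,t}^{\alpha}u(x,t)=\nu\Delta_x u(x,t)+F(x,t),\quad (x,t)\in\Omega,$$ with $u(x,1)=\varphi(x)$ for $x\in\bar G$ and $u(x,t)=\psi(x,t)$ for $x\in\partial G$, $1\le t\le T$. If $F(x,t)\le 0$ for all $(x,t)\in\overline\Omega$, then $$u(x,t)\ \le\ \max\Bigl\{\max_{\partial G\times[1,T]}\psi,\ \max_{\bar G}\varphi\Bigr\}\quad\text{for all }(x,t)\in\overline\Omega .$$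
   Context: $\Delta_x u=\sum_{j=1}^n\partial^2u/\partial x_j^2$, $\overline\Omega=\bar G\times[1,T]$, and $D_{*,t}^{\alpha}$ is the Hadamard-type fractional derivative in $t$ with base point $1$: $$D_{*,t}^{\alpha}u(x,t)=\frac{1}{\Gamma(1-\alpha)}\int_1^t\left(\log\frac{t}{s}\right)^{-\alpha}\frac{\partial u}{\partial s}(x,s)\,ds .$$ Solutions are classical: $u\in C(\overline\Omega)$ is real-valued, $u(\cdot,t)\in C^2(G)$ for each $t\in(1,T]$, $u(x,\cdot)\in W^1_2([1,T])$ (Sobolev space) for each $x\in G$, the integral defining $D_{*,t}^{\alpha}u(x,t)$ converges absolutely at every $(x,t)\in\Omega$, and the equation holds at every point of $\Omega$. *)

(* Defs.v *)
From HB Require Import structures.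
From mathcomp Require Import all_boot all_order all_algebra.
From mathcomp Require Import all_classical all_reals all_analysis.

Set Implicit Arguments.
Unset Strict Implicit.
Unset Printing Implicit Defensive.

Import Order.TTheory GRing.Theory Num.Theory.
Import numFieldNormedType.Exports.

Local Open Scope classical_set_scope.
Local Open Scope ring_scope.

Section Space.
Context {R : realType}.

Definition partial n (j : 'I_n) (f : 'rV[R]_n -> R) : 'rV[R]_n -> R :=
  'D_(delta_mx ord0 j) f.

Definition laplacian n (f : 'rV[R]_n -> R) (x : 'rV[R]_n) : R :=
  \sum_(j < n) partial j (partial j f) x.

(* f is of class C^k on U; meant for U open, so that the partial derivatives
   at points of U only depend on the restriction of f to U. *)
Fixpoint Ck_on n (k : nat) (U : set 'rV[R]_n) (f : 'rV[R]_n -> R) : Prop :=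
  (forall x, U x -> {for x, continuous f}) /\
  (if k is k'.+1 then
     forall j : 'I_n,
       (forall x, U x -> derivable f x (delta_mx ord0 j)) /\
       Ck_on k' U (partial j f)
   else True).

Definition boundary n (G : set 'rV[R]_n) : set 'rV[R]_n :=
  closure G `\` interior G.

(* A domain is a nonempty connected open set. *)
Definition domain n (G : set 'rV[R]_n) : Prop :=
  [/\ G !=set0, open G & connected G].

(* Near each of its boundary points, G lies on one side of the graph of a
   C^oo function gamma of all the coordinates but the i-th one: it is
   {x_i > gamma} if b = false and {x_i < gamma} if b = true. *)
Definition smooth_boundary n (G : set 'rV[R]_n.+1) : Prop :=
  forall p, boundary G p ->
  exists (i : 'I_n.+1) (b : bool) (gamma : 'rV[R]_n -> R),
    (forall k, Ck_on k setT gamma) /\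
    \forall x \near p,
      G x <-> 0 < (-1) ^+ b * (x ord0 i - gamma (col' i x)).

End Space.

Section Time.
Context {R : realType}.

Local Notation mu := (@lebesgue_measure R).

(* The elements of C_c^oo(]a, b[), extended by 0 to the whole line. *)
Definition test_function (a b : R) (phi : R -> R) : Prop :=
  (forall k x, derivable (derive1n k phi) x 1) /\
  exists c d, [/\ a < c, d < b &
    forall x, x \notin `[c, d] -> phi x = 0].

Definition is_weak_derivative (a b : R) (f g : R -> R) : Prop :=
  locally_integrable `]a, b[%classic g /\
  forall phi, test_function a b phi ->
    \int[mu]_(s in `]a, b[) (f s * derive1 phi s) =
    - \int[mu]_(s in `]a, b[) (g s * phi s).

Definition square_integrable (D : set R) (f : R -> R) : Prop :=
  measurable_fun D f /\ mu.-integrable D (EFin \o (fun s => f s ^+ 2)).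

Definition W12 (a b : R) (f : R -> R) : Prop :=
  square_integrable `[a, b] f /\
  exists g, is_weak_derivative a b f g /\ square_integrable `[a, b] g.

(* A representative of the weak derivative, which is unique almost everywhere
   on ]a, b[; it is only used under integrals. *)
Definition weak_derive (a b : R) (f : R -> R) : R -> R :=
  xget (fun=> 0) [set g | is_weak_derivative a b f g].

Definition Gamma (z : R) : R :=
  \int[mu]_(x in `]0, +oo[) (x `^ (z - 1) * expR (- x)).

Definition hadamard_integrand (alpha T : R) (f : R -> R) (t s : R) : R :=
  ln (t / s) `^ (- alpha) * weak_derive 1 T f s.

Definition hadamard_cvg (alpha T : R) (f : R -> R) (t : R) : Prop :=
  mu.-integrable `[1, t] (EFin \o hadamard_integrand alpha T f t).

(* The Hadamard-type derivative of order alpha with base point 1, of a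
   function f on [1, T], at the point t. *)
Definition hadamard_derive (alpha T : R) (f : R -> R) (t : R) : R :=
  (Gamma (1 - alpha))^-1 *
  \int[mu]_(s in `[1, t]) hadamard_integrand alpha T f t s.

(* The greatest element of A (0 if there is none). *)
Definition set_max (A : set R) : R := xget 0 (A `&` ubound A).

End Time.

(* Main.v *)
Require Import Defs.
From HB Require Import structures.
From mathcomp Require Import all_boot all_order all_algebra.
From mathcomp Require Import all_classical all_reals all_analysis.
From mathcomp Require Import measurable_realfun ring lra.

Set Implicit Arguments.
Unset Strict Implicit.
Unset Printing Implicit Defensive.

Import Order.TTheory GRing.Theory Num.Theory.
Import numFieldNormedType.Exports.

Local Open Scope classical_set_scope.
Local Open Scope ring_scope.

(** Fix [e > 0] and let [(x0, t0)] be a maximum point of [u x t + e * |x|^2]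
    over the compact set [closure G `*` `[1, T]].  If [t0 = 1] or [x0] lies on
    the boundary, then [u x0 t0] is bounded by the initial and boundary data,
    and the bound on [u] follows, up to [e * max |x|^2], which vanishes as [e]
    tends to [0].  Otherwise the equation itself fails at [(x0, t0)]:

    - in space, [u ^~ t0] plus the strictly convex function [e * |x|^2] has an
      interior maximum at [x0], so every second partial derivative of [u] is
      at most [- 2 e] there, and the Laplacian is negative
      ([laplacian_at_perturbed_max]);
    - in time, the perturbation does not depend on [t], so [u x0] attains at
      [t0] its maximum over [[1, t0]], and this forces its Hadamard derivative
      at [t0] to be nonnegative ([hadamard_derive_ge0_at_max]).

    As [F <= 0], the left-hand side of the equation would be nonnegative and
    its right-hand side negative.

    The second item is where the singular kernel and the weak derivative have
    to be dealt with.  Write [f] for [u x0], [g] for its weak derivative and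
    [k s] for the kernel [ln (t0 / s) `^ (- alpha)], which is nonnegative and
    nondecreasing on [[1, t0[].  Cutting [k] into horizontal layers,
      [\int k g = \int_(y > 0) (\int_(s | k s > y) g s)],
    and each nonempty superlevel set is an interval ending at [t0],
    say with left end [r], so that the inner integral equals
    [f t0 - f r >= 0].  Fubini's theorem applies because the absolute integral
    of the two-variable integrand is that of [k g], finite by assumption
    ([layer_cake_ge0]).

    The identity [\int_r^t0 g = f t0 - f r] for a continuous [f]
    ([weak_derivative_integral]) comes from testing the definition of the weak
    derivative with smooth plateaus converging to the indicator of []r, t0[];
    these are built from [exp (- 1 / x)]. *)

(** * Smooth functions *)

Section SmoothFunctions.
Context {R : realType}.
Implicit Types (p : {poly R}) (f g : R -> R).

(** For [p = 1] this is the classical flat function; allowing a polynomial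
    factor makes the family closed under differentiation. *)
Definition flat p (x : R) : R :=
  if 0 < x then p.[x^-1] * expR (- x^-1) else 0.

Lemma flat_pos p x : 0 < x -> flat p x = p.[x^-1] * expR (- x^-1).
Proof. by rewrite /flat => ->. Qed.

Lemma flat_neg p x : x <= 0 -> flat p x = 0.
Proof. by rewrite /flat ltNge => ->. Qed.

(** Trades a factor [x] for a degree of the polynomial: since every member of
    the family is bounded, it follows that every member is [O(x)], and that
    its difference quotient at [0] is again a member. *)
Lemma flat_mulX p x : flat p x = x * flat (p * 'X) x.
Proof.
rewrite /flat; case: ifP => [x0|]; last by rewrite mulr0.
rewrite hornerMX; field; exact: lt0r_neq0.
Qed.

Lemma expXn_expRN_le n (y : R) : 0 < y -> y ^+ n * expR (- y) <= n`!%:R.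
Proof.
move=> y0; rewrite expRN ler_pdivrMr ?expR_gt0//.
case: n => [|n]; first by rewrite expr0 fact0 mul1r ltW// expR_gt1.
have := expR_ge1Dxn n (ltW y0) => /(le_trans _) h.
rewrite -ler_pdivrMl ?ltr0n ?fact_gt0// mulrC.
by apply: le_trans (expR_ge1Dxn n (ltW y0)); rewrite lerDr ler01.
Qed.

Lemma flat_bounded p : exists2 C, 0 <= C & forall x, `|flat p x| <= C.
Proof.
exists (\sum_(i < size p) `|p`_i| * i`!%:R).
  by apply: sumr_ge0 => i _; rewrite mulr_ge0.
move=> x; have [x0|x0] := ltP 0 x; last first.
  by rewrite flat_neg// normr0; apply: sumr_ge0 => i _; rewrite mulr_ge0.
rewrite flat_pos// horner_coef mulr_suml (le_trans (ler_norm_sum _ _ _))//.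
apply: ler_sum => i _; rewrite -mulrA normrM ler_wpM2l//.
rewrite ger0_norm ?expXn_expRN_le ?invr_gt0//.
by rewrite mulr_ge0 ?expR_ge0// exprn_ge0// invr_ge0 ltW.
Qed.

Lemma flat_continuous0 p : {for 0, continuous (flat p)}.
Proof.
have [C C0 hC] := flat_bounded (p * 'X).
rewrite /prop_for /continuous_at flat_neg//.
apply/cvgrPdist_le => /= e e0.
have eC : 0 < e / (C + 1) by rewrite divr_gt0// ltr_wpDl.
near=> x; rewrite sub0r normrN flat_mulX normrM.
apply: (@le_trans _ _ (`|x| * (C + 1))).
  by rewrite ler_wpM2l// (le_trans (hC x))// lerDl.
rewrite -ler_pdivlMr ?ltr_wpDl//.
Unshelve. all: by end_near. Qed.

(** Away from [0] this is the chain rule.  At [0] the difference quotient of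
    [flat p] is [flat (p * 'X)], which tends to [0]. *)
Lemma is_derive_flat p (x : R) :
  is_derive x 1 (flat p) (flat ('X^2 * (p - p^`())) x).
Proof.
have [x0|x0|->] := ltgtP x 0.
- rewrite (flat_neg _ (ltW x0)).
  apply: (@near_eq_is_derive _ _ _ (cst 0)).
  near=> y; rewrite flat_neg//; apply/ltW; near: y; exact: lt_nbhsl.
- apply: (@near_eq_is_derive _ _ _ (fun y : R => p.[y^-1] * expR (- y^-1))).
  + near=> y; rewrite flat_pos//; near: y; exact: lt_nbhsr.
  + rewrite flat_pos//.
    have dV : is_derive x 1 (fun y : R => y^-1) (- (x ^- 2)).
      apply: is_derive_eq; first exact: (is_deriveV (lt0r_neq0 x0)).
      by rewrite scaler1.
    have dNV : is_derive x 1 (fun y : R => - y^-1) (x ^- 2).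
      by apply: is_derive_eq; rewrite opprK.
    have dp := @is_derive1_comp _ (horner p) _ x _ _ _ dV.
    have de := @is_derive1_comp _ expR _ x _ _ _ dNV.
    have := is_deriveM (dp _ (is_derive_poly p _)) (de _ (is_derive_expR _)).
    move=> h; apply: (is_derive_eq h).
    rewrite !hornerE /GRing.scale/=. field; exact: lt0r_neq0.
- rewrite (flat_neg _ (lexx 0)); apply/is_derive1_caratheodory.
  (* [flat_mulX] exhibits the slope function of Caratheodory's criterion *)
  exists (flat (p * 'X)); split; [|exact: flat_continuous0|exact: flat_neg].
  by move=> z; rewrite (flat_neg _ (lexx 0)) !subr0 mulrC -flat_mulX.
Unshelve. all: by end_near. Qed.

Lemma is_derive_affine (a b x : R) : is_derive x 1 (fun y => a * y + b) a.
Proof.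
by apply: is_derive_eq; rewrite ?addr0 ?scaler0 ?add0r /GRing.scale/= mulr1.
Qed.

(** A syntactic class of infinitely differentiable functions of a real variable.
    It is not meant to contain all of them: being generated by operations whose
    derivatives it contains, it is closed under differentiation, which yields
    all the higher derivatives by a single induction. *)
Inductive smooth : (R -> R) -> Prop :=
| smooth_cst c : smooth (cst c)
| smooth_flat p : smooth (flat p)
| smoothD f g : smooth f -> smooth g -> smooth (fun x => f x + g x)
| smoothM f g : smooth f -> smooth g -> smooth (fun x => f x * g x)
| smoothV f : smooth f -> (forall x, f x != 0) -> smooth (fun x => (f x)^-1)
| smooth_affine a b f : smooth f -> smooth (fun x => f (a * x + b)).

Lemma smooth_is_derive f : smooth f ->
  exists2 f', smooth f' & forall x : R, is_derive x 1 f (f' x).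
Proof.
elim=> {f} [c|p|f g _ [f' sf' df] _ [g' sg' dg]|
  f g sf [f' sf' df] sg [g' sg' dg]|f sf [f' sf' df] f0|a b f _ [f' sf' df]].
- by exists (cst 0); [exact: smooth_cst|move=> x; exact: is_derive_cst].
- by exists (flat ('X^2 * (p - p^`()))); [exact: smooth_flat|exact: is_derive_flat].
- by exists (fun x => f' x + g' x); [exact: smoothD|move=> x; exact: is_deriveD].
- exists (fun x => f x * g' x + g x * f' x); last by move=> x; exact: is_deriveM.
  by apply: smoothD; exact: smoothM.
- exists (fun x => (f x)^-1 * (f x)^-1 * (cst (-1) x * f' x)).
    by do !apply: smoothM => //; try exact: smoothV; exact: smooth_cst.
  move=> x; apply: (is_derive_eq (is_deriveV (f0 x) (df x))).
  by rewrite /GRing.scale/=; field; exact: f0.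
- exists (fun x => cst a x * f' (a * x + b)).
    by apply: smoothM; [exact: smooth_cst|exact: smooth_affine].
  move=> x.
  by rewrite mulrC; exact: (@is_derive1_comp _ f (fun y => a * y + b) _ _ _ _ (is_derive_affine a b x)).
Qed.

Lemma smooth_derive1n f k : smooth f -> smooth (derive1n k f).
Proof.
elim: k => // k ih /ih /smooth_is_derive [f' sf' df].
suff -> : derive1n k.+1 f = f' by [].
apply/funext => x; rewrite derive1nS derive1E.
by have := df x => dfx; rewrite derive_val.
Qed.

Lemma smooth_derivable f k (x : R) : smooth f -> derivable (derive1n k f) x 1.
Proof. by move=> /(smooth_derive1n k)/smooth_is_derive[f' _ /(_ x)]; case. Qed.

Lemma smooth_continuous (f : R -> R) : smooth f -> continuous f.
Proof.
move=> /smooth_is_derive[f' _ df] x.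
by apply: differentiable_continuous; apply/derivable1_diffP; case: (df x).
Qed.

Lemma smooth_derive1 (f : R -> R) : smooth f ->
  forall x : R, is_derive x 1 f (derive1 f x).
Proof.
move=> /smooth_is_derive[f' _ df] x.
by rewrite derive1E; apply: DeriveDef => //; case: (df x).
Qed.

End SmoothFunctions.

Section Step.
Context {R : realType}.

(** A smooth transition from [0], for [x <= 0], to [1], for [1 <= x]. *)
Definition step (x : R) : R := flat 1 x / (flat 1 x + flat 1 (1 - x)).

Lemma flat1_ge0 (x : R) : 0 <= flat 1 x.
Proof.
rewrite /flat; case: ifP => // _.
by rewrite hornerE mul1r expR_ge0.
Qed.

Lemma flat1_gt0 (x : R) : 0 < x -> 0 < flat 1 x.
Proof. by move=> x0; rewrite flat_pos// hornerE mul1r expR_gt0. Qed.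

Lemma step_denom_gt0 (x : R) : 0 < flat 1 x + flat 1 (1 - x).
Proof.
have [x0|x0] := ltP 0 x; first by rewrite ltr_pwDl ?flat1_gt0 ?flat1_ge0.
by rewrite ltr_wpDl ?flat1_ge0// flat1_gt0//; lra.
Qed.

Lemma step_le0 (x : R) : x <= 0 -> step x = 0.
Proof. by move=> x0; rewrite /step flat_neg// mul0r. Qed.

Lemma step_ge1 (x : R) : 1 <= x -> step x = 1.
Proof.
move=> x1; rewrite /step (@flat_neg _ _ (1 - x)) ?subr_le0// addr0 divff//.
by rewrite gt_eqF// flat1_gt0//; lra.
Qed.

Lemma step_itv (x : R) : 0 <= step x <= 1.
Proof.
rewrite /step divr_ge0 ?flat1_ge0//=; last exact/ltW/step_denom_gt0.
by rewrite ler_pdivrMr ?step_denom_gt0// mul1r lerDl flat1_ge0.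
Qed.

Lemma smooth_step : smooth step.
Proof.
have s1x : smooth (fun x : R => flat 1 (1 - x)).
  rewrite (_ : (fun x => _) = (fun x => flat 1 (-1 * x + 1))).
    by apply: smooth_affine; exact: smooth_flat.
  by apply/funext => x; rewrite mulN1r addrC.
apply: smoothM; first exact: smooth_flat.
apply: (@smoothV _ (fun x : R => flat 1 x + flat 1 (1 - x))).
  by apply: smoothD => //; exact: smooth_flat.
by move=> x; rewrite gt_eqF// step_denom_gt0.
Qed.

Lemma derive1_step_out (x : R) : x \notin `[0, 1] -> derive1 step x = 0.
Proof.
rewrite in_itv/= negb_and -!ltNge derive1E => /orP[x0|x1].
- transitivity ('D_1 (cst 0) x : R); last exact: derive_cst.
  apply: near_eq_derive; near=> y; rewrite step_le0//; apply/ltW.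
  near: y; exact: lt_nbhsl.
- transitivity ('D_1 (cst (1 : R)) x : R); last exact: derive_cst.
  apply: near_eq_derive; near=> y; rewrite step_ge1//; apply/ltW.
  near: y; exact: lt_nbhsr.
Unshelve. all: by end_near. Qed.

Lemma derive1_step_bounded : exists2 C : R, 0 < C &
  forall x, `|derive1 step x| <= C.
Proof.
have sc : continuous (derive1 step).
  apply: smooth_continuous; exact: (smooth_derive1n 1 smooth_step).
have [c _ hc] := EVT_max ler01 (continuous_subspaceT
  (fun x => continuous_comp (sc x) (@norm_continuous _ R^o _)) ).
exists (`|derive1 step c| + 1); first by rewrite ltr_wpDl.
move=> x; have [x01|x01] := boolP (x \in `[0, 1]).
  by apply: le_trans (hc _ x01) _; rewrite lerDl.
by rewrite derive1_step_out// normr0 addr_ge0.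
Qed.

(** The transition [step] rescaled to take place on [[p, p + d]]; the argument
    is written as an affine function of [x] for [smooth_affine] to apply. *)
Definition step_at (d p x : R) := step (d^-1 * x - d^-1 * p).

Lemma step_at_le d p x : 0 < d -> x <= p -> step_at d p x = 0.
Proof.
move=> d0 xp; rewrite /step_at step_le0// -mulrBr.
by rewrite pmulr_rle0 ?invr_gt0// subr_le0.
Qed.

Lemma step_at_ge d p x : 0 < d -> p + d <= x -> step_at d p x = 1.
Proof.
move=> d0 xp; rewrite /step_at step_ge1// -mulrBr ler_pdivlMl// mulr1.
by rewrite lerBrDl.
Qed.

Lemma smooth_step_at d p : smooth (step_at d p).
Proof. exact/smooth_affine/smooth_step. Qed.

Lemma derive1_step_at d p x :
  derive1 (step_at d p) x = d^-1 * derive1 step (d^-1 * x - d^-1 * p).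
Proof.
have dl := is_derive_affine d^-1 (- (d^-1 * p)) x.
have := @is_derive1_comp _ step _ _ _ _ (smooth_derive1 smooth_step _) dl.
by move=> h; rewrite derive1E mulrC; exact: (@derive_val _ _ _ _ _ _ _ h).
Qed.

Lemma derive1_step_at_out d p x : 0 < d -> x \notin `[p, p + d] ->
  derive1 (step_at d p) x = 0.
Proof.
move=> d0; rewrite in_itv/= => xpd.
rewrite derive1_step_at derive1_step_out ?mulr0// in_itv/= -mulrBr.
apply: contra xpd; rewrite pmulr_rge0 ?invr_gt0// ler_pdivrMl// mulr1.
by rewrite subr_ge0 lerBlDl.
Qed.

End Step.

(** * Integrating a weak derivative *)

Section WeakFTC.
Context {R : realType}.
Local Notation mu := (@lebesgue_measure R).

(** A smooth approximation of the indicator of [[a, b]] with support in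
    [[a + d, b - d]].  Both transitions lie strictly inside [[a, b]], so that
    it is a test function even when [[a, b]] is the whole interval. *)
Definition plateau (a b d x : R) : R :=
  step_at d (a + d) x - step_at d (b - 2 * d) x.

Lemma smooth_plateau a b d : smooth (plateau a b d).
Proof.
rewrite (_ : plateau a b d =
  (fun x => step_at d (a + d) x + cst (-1) x * step_at d (b - 2 * d) x)).
  by apply: smoothD; [|apply: smoothM; [exact: smooth_cst|]]; exact: smooth_step_at.
by apply/funext => x; rewrite /plateau mulN1r.
Qed.

Lemma derive1_plateau a b d x : derive1 (plateau a b d) x =
  derive1 (step_at d (a + d)) x - derive1 (step_at d (b - 2 * d)) x.
Proof.
have h p := smooth_derive1 (smooth_step_at d p) x.
have := is_deriveB (h (a + d)) (h (b - 2 * d)).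
by rewrite [LHS]derive1E => {}h; exact: (@derive_val _ _ _ _ _ _ _ h).
Qed.

Lemma plateau_out a b d x : 0 < d -> 3 * d <= b - a ->
  x \notin `[a + d, b - d] -> plateau a b d x = 0.
Proof.
move=> d0 dab; rewrite in_itv/= negb_and -!ltNge => /orP[xa|bx].
  by rewrite /plateau !step_at_le ?subr0//; lra.
by rewrite /plateau !step_at_ge ?subrr//; lra.
Qed.

Lemma plateau_in a b d x : 0 < d -> a + 2 * d <= x <= b - 2 * d ->
  plateau a b d x = 1.
Proof.
move=> d0 /andP[ax xb].
by rewrite /plateau step_at_ge ?step_at_le ?subr0//; lra.
Qed.

Lemma normr_plateau_le1 a b d x : `|plateau a b d x| <= 1.
Proof.
rewrite /plateau /step_at.
have /andP[s0 s1] := step_itv (d^-1 * x - d^-1 * (a + d)).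
have /andP[t0 t1] := step_itv (d^-1 * x - d^-1 * (b - 2 * d)).
by rewrite ler_norml; apply/andP; split; lra.
Qed.

Lemma test_function_plateau A B a b d : A <= a -> b <= B -> 0 < d ->
  3 * d <= b - a -> test_function A B (plateau a b d).
Proof.
move=> Aa bB d0 dab; split.
  by move=> k x; apply: smooth_derivable; exact: smooth_plateau.
exists (a + d), (b - d); split; [lra|lra|].
by move=> x; exact: plateau_out.
Qed.

(* With [n + 3] in place of [n], the widths satisfy [3 * d <= b - a], which
   keeps the two transitions of the plateau apart. *)
Let delta (a b : R) (n : nat) : R := (b - a) / n.+3%:R.

Let delta_gt0 a b n : a < b -> 0 < delta a b n.
Proof. by move=> ab; rewrite divr_gt0 ?subr_gt0. Qed.

Let delta3 a b n : a < b -> 3 * delta a b n <= b - a.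
Proof.
move=> ab; rewrite /delta mulrA ler_pdivrMr// mulrC ler_pM2l ?subr_gt0//.
by rewrite ler_nat.
Qed.

Let delta_small a b (e : R) : a < b -> 0 < e ->
  \forall n \near \oo, delta a b n <= e.
Proof.
move=> ab e0; near=> n; rewrite /delta ler_pdivrMr// mulrC -ler_pdivrMr//.
apply: (@le_trans _ _ n%:R); last by rewrite ler_nat -addn3 leq_addr.
by near: n; exact: nbhs_infty_ger.
Unshelve. all: by end_near. Qed.

Lemma within_continuous_dist (A B c e : R) (f : R -> R) :
  {within `[A, B], continuous f} -> c \in `[A, B] -> 0 < e ->
  exists2 r, 0 < r & forall x, x \in `[A, B] -> `|x - c| < r ->
    `|f x - f c| <= e.
Proof.
move=> /subspace_continuousP cf cAB e0.
have /cvgrPdist_le/(_ _ e0) := cf _ cAB.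
rewrite near_withinE => /nbhs_ballP[r /= r0 hr]; exists r => // x xAB xr.
by rewrite distrC; apply: hr => //; rewrite /ball/= distrC.
Qed.

Lemma Rintegral_subset (D E : set R) (f : R -> R) : D `<=` E ->
  (forall x, E x -> ~ D x -> f x = 0) ->
  \int[mu]_(x in E) f x = \int[mu]_(x in D) f x.
Proof.
move=> DE fE; rewrite Rintegral_mkcond [RHS]Rintegral_mkcond.
apply: eq_Rintegral => x _; rewrite !patchE.
have [xD|xD] := boolP (x \in D); first by rewrite mem_set//; apply: DE; exact: set_mem.
case: ifPn => // /set_mem Ex; apply: fE => // Dx.
by rewrite mem_set in xD.
Qed.

(** The derivatives of the rescaled steps are an approximate identity: they
    have integral [1] and, being at most [C / d] in absolute value on an
    interval of length [d], an L1 norm of at most [C]. *)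
Lemma Rintegral_derive1_step_at (A B p d y e C : R) (f : R -> R) :
  (forall x, `|derive1 step x| <= C) ->
  0 < d -> A < p -> p + d < B ->
  {within `[A, B], continuous f} ->
  (forall x, x \in `[p, p + d] -> `|f x - y| <= e) ->
  `|\int[mu]_(x in `]A, B[) (f x * derive1 (step_at d p) x) - y| <= e * C.
Proof.
move=> hC d0 Ap pB cf hf.
have ppd : p < p + d by rewrite ltrDl.
set s := derive1 (step_at d p).
have cs : continuous s.
  by apply: smooth_continuous; exact: (smooth_derive1n 1 (smooth_step_at d p)).
have sub : `[p, p + d] `<=` `[A, B].
  by move=> x /=; rewrite !in_itv/= => /andP[px xp]; apply/andP; split; lra.
have cfp : {within `[p, p + d], continuous f} by exact: continuous_subspaceW cf.
have is_ : mu.-integrable `[p, p + d] (EFin \o s).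
  apply: continuous_compact_integrable; first exact: segment_compact.
  exact: continuous_subspaceT.
have ifs : mu.-integrable `[p, p + d] (EFin \o (fun x => (f x - y) * s x)).
  apply: continuous_compact_integrable; first exact: segment_compact.
  move=> x; apply: cvgM; last exact: (continuous_subspaceT cs).
  by apply: cvgB; [exact: cfp|exact: cvg_cst].
have int1 : \int[mu]_(x in `[p, p + d]) s x = 1.
  rewrite /Rintegral (@continuous_FTC2 _ s (step_at d p))//.
  - by rewrite step_at_ge// step_at_le// -EFinB subr0.
  - exact: continuous_subspaceT.
  - have cst_ := smooth_continuous (smooth_step_at d p).
    split.
    + by move=> x _; case: (smooth_derive1 (smooth_step_at d p) x).
    + by apply: cvg_at_right_filter; exact: cst_.
    + by apply: cvg_at_left_filter; exact: cst_.
rewrite (@Rintegral_subset `[p, p + d]); first last.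
- by move=> x _ /negP xpd; rewrite /s derive1_step_at_out ?mulr0.
- by move=> x /=; rewrite !in_itv/= => /andP[px xp]; apply/andP; split; lra.
have -> : \int[mu]_(x in `[p, p + d]) (f x * s x) - y =
    \int[mu]_(x in `[p, p + d]) ((f x - y) * s x).
  rewrite -[in LHS](mulr1 y) -int1 -RintegralZl// -RintegralB//.
  - by apply: eq_Rintegral => x _; rewrite mulrBl.
  - apply: continuous_compact_integrable; first exact: segment_compact.
    by move=> x; apply: cvgM; [exact: cfp|exact: (continuous_subspaceT cs)].
  - apply: continuous_compact_integrable; first exact: segment_compact.
    apply: continuous_subspaceT => x.
    by apply: cvgM; [exact: cvg_cst|exact: cs].
apply: le_trans (le_normr_Rintegral _ ifs) _ => //.
have e0 : 0 <= e by apply: le_trans (hf p _); rewrite ?normr_ge0// in_itv/= lexx ltW.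
apply: (@le_trans _ _ (\int[mu]_(x in `[p, p + d]) (e * (d^-1 * C)))).
  apply: le_Rintegral => //.
  - exact: integrable_norm.
  - apply: continuous_compact_integrable; first exact: segment_compact.
    by apply: continuous_subspaceT => x; exact: cst_continuous.
  - move=> x xpd; rewrite normrM ler_pM//; first exact: hf.
    rewrite /s derive1_step_at normrM gtr0_norm ?invr_gt0// ler_wpM2l//.
    by rewrite invr_ge0 ltW.
rewrite Rintegral_cst// /= lebesgue_measure_itv/= lte_fin ppd -EFinD /=.
by rewrite le_eqVlt; apply/orP; left; apply/eqP; field; exact: lt0r_neq0.
Qed.

(** For the plateaus [P n] of transition width tending to [0],
    [\int f (P n)' = - \int g (P n)].  The right-hand side tends to
    [- \int_a^b g] by dominated convergence.  On the left, [(P n)'] is the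
    difference of an approximate identity at [a] and one at [b], so the limit
    is [f a - f b]. *)
Lemma weak_derivative_integral (A B a b : R) (f g : R -> R) :
  A <= a -> a < b -> b <= B ->
  {within `[A, B], continuous f} -> is_weak_derivative A B f g ->
  mu.-integrable `]a, b[ (EFin \o g) ->
  \int[mu]_(x in `]a, b[) g x = f b - f a.
Proof.
move=> Aa ab bB cf [_ fg] ig.
pose d := delta a b; pose P n := plateau a b (d n).
have d0 n : 0 < d n by exact: delta_gt0.
have d3 n : 3 * d n <= b - a by exact: delta3.
have cP n : continuous (P n) by exact/smooth_continuous/smooth_plateau.
have gP : \int[mu]_(x in `]a, b[) (g x * P n x) @[n --> \oo] -->
    \int[mu]_(x in `]a, b[) g x.
  have mg : measurable_fun `]a, b[ g.
    by apply/measurable_EFinP; exact: measurable_int ig.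
  apply: fine_cvg; rewrite fineK; last exact: integrable_fin_num.
  have [||||||_ _ //] := @dominated_convergence _ _ _ mu `]a, b[ _
      (fun n x => (g x * P n x)%:E) (EFin \o g) (fun x => `|g x|%:E).
  - by [].
  - move=> n; apply/measurable_EFinP; apply: measurable_funM => //.
    by apply: measurable_funTS; exact: continuous_measurable_fun.
  - by apply/measurable_EFinP.
  - apply: aeW => x; rewrite /= in_itv/= => /andP[ax xb].
    apply: cvg_near_cst.
    have e0 : 0 < Num.min (x - a) (b - x) / 2.
      by rewrite divr_gt0// lt_min !subr_gt0 ax.
    near=> n.
    have : d n <= Num.min (x - a) (b - x) / 2 by near: n; exact: delta_small.
    rewrite ler_pdivlMr// le_min => /andP[h1 h2].
    by rewrite /P plateau_in ?mulr1//; apply/andP; split; lra.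
  - exact: integrable_norm.
  - apply: aeW => x n _; rewrite /= lee_fin normrM ler_piMr//.
    exact: normr_plateau_le1.
have fP : (- \int[mu]_(x in `]A, B[) (f x * derive1 (P n) x)) @[n --> \oo] -->
    f b - f a.
  have [C C0 hC] := @derive1_step_bounded R.
  have fS c (c_ : nat -> R) : c \in `[a, b] ->
    (forall n, A < c_ n /\ c_ n + d n < B) ->
    (forall n x, x \in `[c_ n, c_ n + d n] -> `|x - c| <= 2 * d n) ->
    \int[mu]_(x in `]A, B[) (f x * derive1 (step_at (d n) (c_ n)) x)
      @[n --> \oo] --> f c.
    move=> cab c_AB hc.
    have cAB : c \in `[A, B].
      by move: cab; rewrite !in_itv/= => /andP[ac cb]; apply/andP; split; lra.
    apply/cvgrPdist_le => /= e e0.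
    have eC : 0 < e / C by rewrite divr_gt0.
    have [r r0 hr] := within_continuous_dist cf cAB eC.
    have r3 : 0 < r / 3 by rewrite divr_gt0.
    near=> n.
    have dnr : d n <= r / 3 by near: n; exact: delta_small.
    have [Ac cB] := c_AB n.
    rewrite distrC -(divfK (lt0r_neq0 C0) e).
    apply: Rintegral_derive1_step_at => // x xc.
    apply: hr; last first.
      by apply: le_lt_trans (hc _ _ xc) _; lra.
    by move: xc; rewrite !in_itv/= => /andP[h1 h2]; apply/andP; split; lra.
  have -> : f b - f a = - (f a - f b) by rewrite opprB.
  apply: cvgN.
  have ifs p e : mu.-integrable `]A, B[
      (EFin \o (fun x => f x * derive1 (step_at e p) x)).
    apply: (@integrableS _ _ _ mu `[A, B]) => //.
      exact: subset_itv_oo_cc.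
    apply: continuous_compact_integrable; first exact: segment_compact.
    have cs : continuous (derive1 (step_at e p)).
      exact/smooth_continuous/(smooth_derive1n 1 (smooth_step_at e p)).
    by move=> x; apply: cvgM; [exact: cf|exact: (continuous_subspaceT cs)].
  rewrite (_ : (fun n => _) = (fun n =>
    \int[mu]_(x in `]A, B[) (f x * derive1 (step_at (d n) (a + d n)) x) -
    \int[mu]_(x in `]A, B[) (f x * derive1 (step_at (d n) (b - 2 * d n)) x))).
    apply: cvgB; apply: fS.
    - by rewrite in_itv/= lexx ltW.
    - by move=> n; have := d0 n; have := d3 n; split; lra.
    - move=> n x; rewrite in_itv/= => /andP[h1 h2]; have := d0 n.
      by rewrite ler_norml => ?; apply/andP; split; lra.
    - by rewrite in_itv/= lexx ltW.
    - by move=> n; have := d0 n; have := d3 n; split; lra.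
    - move=> n x; rewrite in_itv/= => /andP[h1 h2]; have := d0 n.
      by rewrite ler_norml => ?; apply/andP; split; lra.
  apply/funext => n; rewrite -RintegralB//.
  by apply: eq_Rintegral => x _; rewrite derive1_plateau mulrBr.
suff PE : (fun n => - \int[mu]_(x in `]A, B[) (f x * derive1 (P n) x)) =
    (fun n => \int[mu]_(x in `]a, b[) (g x * P n x)).
  by rewrite PE in fP; exact: (cvg_unique _ gP fP).
apply/funext => n; rewrite fg ?opprK; last exact: test_function_plateau.
apply: Rintegral_subset.
  by move=> x /=; rewrite !in_itv/= => /andP[ax xb]; apply/andP; split; lra.
move=> x _ /= xab; rewrite /P plateau_out ?mulr0//.
apply/negP => xd; apply: xab; move: xd; rewrite !in_itv/= => /andP[h1 h2].
by have := d0 n => d0n; apply/andP; split; lra.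
Unshelve. all: by end_near. Qed.

End WeakFTC.

(** * Integrals against a nondecreasing kernel *)

Section LayerCake.
Context {R : realType}.
Local Notation mu := (@lebesgue_measure R).

(** A final segment of [[a, b[] is an interval with right end [b], which may
    or may not contain its infimum; a single point does not change the
    integral. *)
Lemma integral_final_segment_ge0 (a b : R) (g : R -> R) (J : set R) :
  J `<=` `[a, b[ ->
  (forall x y, J x -> x <= y -> y < b -> J y) ->
  (forall r, a <= r -> r < b -> (0 <= \int[mu]_(s in `]r, b[) (g s)%:E)%E) ->
  measurable_fun `[a, b[ g ->
  (0 <= \int[mu]_(s in J) (g s)%:E)%E.
Proof.
move=> Jab Jup gr mg.
have [[x0 Jx0]|/nonemptyPn->] := pselect (J !=set0); last by rewrite integral_set0.
have lbJ : lbound J a by move=> x /Jab; rewrite /= in_itv/= => /andP[].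
have infJ : has_inf J by split; [exists x0|exists a].
have ac : a <= inf J by apply: lb_le_inf => //; exists x0.
have cb : inf J < b.
  apply: (@le_lt_trans _ _ x0); first by apply: ge_inf => //; exists a.
  by move: (Jab _ Jx0); rewrite /= in_itv/= => /andP[].
have Jgt y : inf J < y -> y < b -> J y.
  move=> cy yb; have [x Jx xy] := inf_lt infJ.1 cy.
  by apply: Jup Jx _ yb; exact: ltW.
have Jle y : J y -> inf J <= y by move=> Jy; apply: ge_inf => //; exists a.
have Jb y : J y -> y < b by move=> /Jab; rewrite /= in_itv/= => /andP[].
have mgo : measurable_fun `]inf J, b[ (EFin \o g).
  apply/measurable_EFinP; apply: measurable_funS mg => //.
  move=> x /=; rewrite !in_itv/= => /andP[cx ->]; rewrite andbT.
  exact: le_trans (ltW cx).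
have [Jc|Jc] := pselect (J (inf J)).
- rewrite (_ : J = `[inf J, b[%classic); first by rewrite -integral_itv_obnd_cbnd// gr.
  apply/seteqP; split=> [y Jy|y]; rewrite /= in_itv/=; first by rewrite Jle ?Jb.
  by move=> /andP[]; rewrite le_eqVlt => /orP[/eqP<-//|]; exact: Jgt.
- rewrite (_ : J = `]inf J, b[%classic); first exact: gr.
  apply/seteqP; split=> [y Jy|y]; rewrite /= in_itv/=.
    by rewrite Jb// andbT lt_neqAle Jle// andbT; apply: contra_notN Jc => /eqP->.
  by move=> /andP[]; exact: Jgt.
Qed.

(** Since [k s] is the measure of the [y] with [0 < y < k s], the integral of
    [k g] is that of [g s] over the region [0 < y < k s] of the plane.  For a
    fixed [y], monotonicity of [k] makes the slice of this region a final
    segment of [[a, b[]. *)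
Lemma layer_cake_ge0 (a b : R) (k g : R -> R) :
  measurable_fun `[a, b[ k ->
  (forall s, s \in `[a, b[ -> 0 <= k s) ->
  {in `[a, b[ &, {homo k : x y / x <= y}} ->
  mu.-integrable `[a, b[ (EFin \o g) ->
  mu.-integrable `[a, b[ (EFin \o (fun s => k s * g s)) ->
  (forall r, a <= r -> r < b -> (0 <= \int[mu]_(s in `]r, b[) (g s)%:E)%E) ->
  0 <= \int[mu]_(s in `[a, b[) (k s * g s).
Proof.
move=> mk k0 kmono ig ikg gr.
set D : set R := `[a, b[%classic.
pose G := g \_ D; pose K := k \_ D.
have mg : measurable_fun D g by apply/measurable_EFinP; exact: measurable_int ig.
have mG : measurable_fun setT G.
  exact: (measurable_restrictT g (measurable_itv _)).1 mg.
have mK : measurable_fun setT K.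
  exact: (measurable_restrictT k (measurable_itv _)).1 mk.
have K0 x : 0 <= K x.
  by rewrite /K patchE; case: ifPn => // /set_mem; exact: k0.
have KGE x : K x * G x = ((fun s => k s * g s) \_ D) x.
  by rewrite /K /G !patchE; case: ifPn => // _; rewrite mulr0.
pose E : set (R * R) := [set p | (0 < p.2) && (p.2 < K p.1)].
have mE : measurable E.
  have mlt0 : measurable_fun setT (fun p : R * R => 0 < p.2).
    by apply: measurable_fun_ltr => //; exact: measurable_snd.
  have mltK : measurable_fun setT (fun p : R * R => p.2 < K p.1).
    by apply: measurable_fun_ltr; [exact: measurable_snd|exact: measurableT_comp].
  have := measurable_and mlt0 mltK measurableT (Y := [set true]) I.
  by rewrite setTI.
pose F : R * R -> \bar R := (fun p => (G p.1)%:E) \_ E.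
have mF : measurable_fun setT F.
  have mG1 : measurable_fun E (G \o fst).
    by apply: measurable_funTS; exact: measurableT_comp.
  exact: (measurable_restrictT (EFin \o (G \o fst)) mE).1 ((measurable_EFinP _ _).2 mG1).
(* stated for a general [h] to cover both [F] and its absolute value *)
have sectionE (h : \bar R -> \bar R) x : h 0%E = 0%E ->
    (\int[mu]_y h (F (x, y)) = h (G x)%:E * (K x)%:E)%E.
  move=> h0; transitivity (\int[mu]_(y in `]0%R, K x[) h (G x)%:E)%E.
    rewrite [RHS]integral_mkcond; apply: eq_integral => y _.
    rewrite /F !patchE; have [yE|yE] := boolP ((x, y) \in E).
      by rewrite mem_set//; move/set_mem: yE => /=; rewrite in_itv.
    rewrite h0; case: ifPn => // /set_mem; rewrite /= in_itv/= => yK.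
    by rewrite mem_set in yE.
  rewrite integral_cst//= lebesgue_measure_itv/= lte_fin.
  have := K0 x; rewrite le_eqVlt => /orP[/eqP<-|K0x]; first by rewrite ltxx.
  by rewrite K0x oppr0 adde0.
have iF : (mu \x mu)%E.-integrable setT F.
  apply/integrable12ltyP => //.
  under eq_integral do rewrite (sectionE abse) ?abse0//.
  move: ikg => /(integrable_mkcond _ _).1 => /(_ (measurable_itv _)).
  move=> /integrableP[_]; congr (_ < _)%E; apply: eq_integral => x _.
  by rewrite restrict_EFin /= -KGE normrM (ger0_norm (K0 x)) mulrC.
have /(congr1 fine) := Fubini iF.
under eq_integral do rewrite (sectionE idfun)//=.
move=> H.
have -> : \int[mu]_(s in D) (k s * g s) = fine (\int[mu]_x ((G x)%:E * (K x)%:E)).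
  rewrite Rintegral_mkcond /Rintegral; congr fine; apply: eq_integral => x _.
  by rewrite -KGE EFinM muleC.
rewrite H; apply: fine_ge0; apply: integral_ge0 => y _.
pose J : set R := [set x | [&& x \in `[a, b[, 0 < y & y < k x]].
rewrite (_ : (\int[mu]_x F (x, y))%E = \int[mu]_(x in J) (g x)%:E)%E.
  apply: (@integral_final_segment_ge0 a b) => //.
  - by move=> x /andP[].
  - move=> x z /and3P[xab y0 yx] xz zb.
    have zab : z \in `[a, b[.
      by move: xab; rewrite !in_itv/= zb andbT => /andP[/le_trans->].
    by apply/and3P; split=> //; rewrite (lt_le_trans yx)// kmono.
rewrite [RHS]integral_mkcond; apply: eq_integral => x _.
rewrite /F /G !patchE; case: ifPn => [/set_mem/andP[/= y0]|xyE].
  rewrite /K patchE; case: ifPn => [xD yk|_ /(lt_trans y0)]; last by rewrite ltxx.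
  by rewrite mem_set//; apply/and3P; split=> //; exact: set_mem.
case: ifPn => // /set_mem/and3P[xab y0 yk].
suff xyE' : E (x, y) by rewrite mem_set in xyE.
by apply/andP; split=> //=; rewrite /K patchE mem_set.
Qed.

End LayerCake.

(** * The Hadamard derivative at a maximum *)

Section Hadamard.
Context {R : realType}.
Local Notation mu := (@lebesgue_measure R).

Definition log_kernel (alpha t s : R) : R := ln (t / s) `^ (- alpha).

Lemma ln_div_gt0 (t s : R) : 1 <= s -> s < t -> 0 < ln (t / s).
Proof. by move=> s1 st; rewrite ln_gt0// ltr_pdivlMr ?mul1r//; lra. Qed.

Lemma log_kernel_homo (alpha t : R) : 0 <= alpha ->
  {in `[1, t[ &, {homo log_kernel alpha t : x y / x <= y}}.
Proof.
move=> alpha0 x y; rewrite !in_itv/= => /andP[x1 xt] /andP[y1 yt] xy.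
have ly := ln_div_gt0 y1 yt; have lx := ln_div_gt0 x1 xt.
rewrite /log_kernel !powRN lef_pV2 ?posrE ?powR_gt0//.
apply: ge0_ler_powR => //; [by rewrite nnegrE ltW|by rewrite nnegrE ltW|].
rewrite ler_ln ?posrE ?divr_gt0//; [|lra..].
by rewrite ler_pM2l ?lef_pV2 ?posrE//; lra.
Qed.

Lemma measurable_log_kernel (alpha t : R) :
  measurable_fun `[1, t[ (log_kernel alpha t).
Proof.
apply: (eq_measurable_fun (fun s => (ln t - ln s) `^ (- alpha))).
  move=> s; rewrite inE/= in_itv/= => /andP[s1 st].
  by rewrite /log_kernel ln_div ?posrE//; lra.
apply: measurable_funTS.
apply: (measurableT_comp (measurable_powR _)).
by apply: measurable_funB => //; exact: measurable_ln.
Qed.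

(** Fractional counterpart of Fermat's rule.  Convergence of the Hadamard
    integral also provides the integrability of the weak derivative [g] up to
    both ends of [[1, t[]: the kernel is bounded below by its value at [1],
    hence [g] is dominated by a multiple of the integrand. *)
Lemma hadamard_derive_ge0_at_max (alpha T t : R) (f : R -> R) :
  0 <= alpha -> 1 < t <= T -> {within `[1, T], continuous f} ->
  W12 1 T f -> hadamard_cvg alpha T f t ->
  (forall s, s \in `[1, t] -> f s <= f t) ->
  0 <= hadamard_derive alpha T f t.
Proof.
move=> alpha0 /andP[t1 tT] cf [_ [g0 [wg0 _]]] fcvg fmax.
set g := weak_derive 1 T f.
have wg : is_weak_derivative 1 T f g by apply: xgetPex; exists g0.
set k := log_kernel alpha t.
have ikg : mu.-integrable `[1, t[ (EFin \o (fun s => k s * g s)).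
  apply: integrableS fcvg => //; exact: subset_itv_co_cc.
have mg : measurable_fun `[1, t[ g.
  apply/measurable_fun_itv_obnd_cbndP; have [[mg _ _] _] := wg.
  apply: measurable_funS mg => //; move=> x /=.
  by rewrite !in_itv/= => /andP[rx xt]; apply/andP; split; lra.
have k1 : 0 < k 1 by rewrite powR_gt0// ln_div_gt0.
have kge s : s \in `[1, t[ -> k 1 <= k s.
  move=> st; apply: log_kernel_homo => //; first by rewrite in_itv/= lexx.
  by move: st; rewrite in_itv/= => /andP[].
have ig : mu.-integrable `[1, t[ (EFin \o g).
  apply: (le_integrable _ _ _ (integrableZl _ (k 1)^-1 ikg)) => //.
  - exact/measurable_EFinP.
  - move=> s st; rewrite /= lee_fin !normrM gtr0_norm ?invr_gt0//.
    by rewrite ler_pdivlMl// ler_wpM2r// (le_trans (kge _ st))// ler_norm.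
have igr r : 1 <= r -> mu.-integrable `]r, t[ (EFin \o g).
  move=> r1; apply: integrableS ig => //; move=> x /=.
  by rewrite !in_itv/= => /andP[rx xt]; apply/andP; split; lra.
rewrite /hadamard_derive mulr_ge0 ?invr_ge0//.
  apply: Rintegral_ge0 => x _; by rewrite mulr_ge0 ?powR_ge0 ?expR_ge0.
rewrite -Rintegral_itv_bndo_bndc//; apply: layer_cake_ge0 => //.
- exact: measurable_log_kernel.
- by move=> s _; exact: powR_ge0.
- exact: log_kernel_homo.
- move=> r r1 rt.
  rewrite -[leRHS]fineK; last exact: integrable_fin_num (igr _ r1).
  rewrite lee_fin -/(Rintegral _ _ _).
  rewrite (weak_derivative_integral r1 rt tT cf wg (igr _ r1)) subr_ge0.
  by apply: fmax; rewrite in_itv/= r1 ltW.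
Qed.

End Hadamard.

(** * The Laplacian at a maximum *)

Section Spatial.
Context {R : realType}.

(** If the second derivative were positive, the first one, which vanishes at
    [c], would be positive just to the right of [c], and [h] would increase
    there by the mean value theorem. *)
Lemma second_derivative_at_max (h : R -> R) (c r : R) : 0 < r ->
  (forall s, s \in `]c - r, c + r[ -> derivable h s 1) ->
  derivable (derive1 h) c 1 ->
  (forall s, s \in `]c - r, c + r[ -> h s <= h c) ->
  derive1 (derive1 h) c <= 0.
Proof.
move=> r0 dh ddh hmax.
have cr : c \in `]c - r, c + r[ by rewrite in_itv/=; apply/andP; split; lra.
have rr : c - r <= c + r by lra.
have h'0 : derive1 h c = 0.
  have dc := derive1_at_max rr dh cr hmax.
  by rewrite derive1E; exact: (@derive_val _ _ _ _ _ _ _ dc).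
rewrite leNgt; apply/negP => h''0.
have : \forall s \near (0 : R)^', 0 < s^-1 *: (derive1 h (s + c) - derive1 h c).
  have hc : s^-1 *: (derive1 h (s + c) - derive1 h c) @[s --> (0 : R)^'] -->
      derive1 (derive1 h) c.
    move: (derive1 h) ddh => g dg; rewrite /derive1.
    suff -> : (fun s : R => s^-1 *: (g (s + c) - g c)) =
      (fun s => s^-1 *: ((g \o shift c) (s *: 1) - g c)) by exact: dg.
    by apply/funext => s /=; rewrite [_%:A]mulr1.
  exact: (cvgr_gt _ hc).
rewrite near_withinE => /nbhs_ballP[e /= e0 he].
pose s := Num.min e r / 2.
have s0 : 0 < s by rewrite divr_gt0// lt_min e0.
have [se sr] : s < e /\ s < r.
  have : s * 2 = Num.min e r by rewrite /s divfK.
  have : Num.min e r <= e by rewrite ge_min lexx.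
  have : Num.min e r <= r by rewrite ge_min lexx orbT.
  by move=> ? ? ?; split; lra.
have sub x : x \in `[c, c + s] -> x \in `]c - r, c + r[.
  by rewrite !in_itv/= => /andP[? ?]; apply/andP; split; lra.
have [|||x xcs E] := @MVT _ h (derive1 h) c (c + s).
- by rewrite ltrDl.
- move=> x xcs; rewrite derive1E; apply: derivableP; apply: dh.
  by apply: sub; exact: subset_itv_oo_cc xcs.
- apply: continuous_in_subspaceT => x /set_mem xcs.
  by apply: differentiable_continuous; apply/derivable1_diffP/dh/sub.
have : h (c + s) <= h c.
  by apply: hmax; apply: sub; rewrite in_itv/= lexx andbT lerDl ltW.
move: xcs; rewrite in_itv/= => /andP[cx xcs].
rewrite -subr_le0 E addrAC subrr add0r pmulr_lle0// leNgt => /negP; apply.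
have := he (x - c).
rewrite /ball/= sub0r normrN gtr0_norm ?subr_gt0// => /(_ _)/wrap[]; first lra.
rewrite subr_eq0 gt_eqF// => /(_ isT); rewrite subrK h'0 subr0.
by rewrite [_ *: _]/(_ * _) pmulr_rgt0// invr_gt0 subr_gt0.
Qed.

(** The perturbation is the increment of [e * |x|^2] along a coordinate line
    through a point whose coordinate in that direction is [y]. *)
Lemma second_derivative_at_perturbed_max (h : R -> R) (y e r : R) : 0 < r ->
  (forall s, s \in `]- r, r[ -> derivable h s 1) ->
  derivable (derive1 h) 0 1 ->
  (forall s, s \in `]- r, r[ -> h s + e * (2 * s * y + s ^+ 2) <= h 0) ->
  derive1 (derive1 h) 0 <= - (2 * e).
Proof.
move=> r0 dh ddh hmax.
pose p (s : R) := e * (2 * s * y + s ^+ 2).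
have dp (s : R) : is_derive s 1 p (e * (2 * y + 2 * s)).
  have h1 := is_deriveM (is_derive_affine e 0 s) (is_derive_affine 1 (2 * y) s).
  rewrite (_ : p = (fun x : R => e * x + 0) * (fun x => 1 * x + 2 * y)).
    by apply: (is_derive_eq h1); rewrite /GRing.scale/=; ring.
  apply/funext => x; transitivity ((e * x + 0) * (1 * x + 2 * y)) => //.
  by rewrite /p; ring.
have dq : is_derive (0 : R) 1 (fun s : R => e * (2 * y + 2 * s)) (2 * e).
  rewrite (_ : (fun s => _) = (fun s => (2 * e) * s + e * (2 * y))).
    exact: is_derive_affine.
  by apply/funext => s; ring.
have E s : s \in `]- r, r[ -> derive1 (h \+ p) s = derive1 h s + e * (2 * y + 2 * s).
  move=> sr; have hs := derivableP (dh _ sr).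
  have := is_deriveD hs (dp s).
  by rewrite derive1E => {}hs; rewrite (@derive_val _ _ _ _ _ _ _ hs) derive1E.
have nE : \forall s \near (0 : R), derive1 h s + e * (2 * y + 2 * s) = derive1 (h \+ p) s.
  near=> s; apply/esym/E; near: s; apply: near_in_itvoo.
  by rewrite in_itv/=; apply/andP; split; lra.
have dd : is_derive (0 : R) 1 (derive1 (h \+ p)) (derive1 (derive1 h) 0 + 2 * e).
  apply: (near_eq_is_derive nE); rewrite derive1E.
  exact: (is_deriveD (derivableP ddh) dq).
have p0 : p 0 = 0 by rewrite /p; ring.
have := @second_derivative_at_max (h \+ p) 0 r r0.
rewrite sub0r add0r derive1E (@derive_val _ _ _ _ _ _ _ dd) /= p0 addr0.
move=> H; rewrite -subr_le0 opprK; apply: H.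
- move=> s sr; apply: derivableD; first exact: dh.
  by case: (dp s).
- exact: (@ex_derive _ _ _ _ _ _ _ dd).
- exact: hmax.
Unshelve. all: by end_near. Qed.

Section Directional.
Variable V : normedModType R.
Implicit Types (U : V -> R) (x v : V).

(** Partial derivatives are ordinary derivatives along a line, with the same
    difference quotients; this transfers both differentiability and values, at
    every order. *)
Lemma growth_rate_line U x v s :
  (fun h : R => h^-1 *:
    (((fun r : R => U (r *: v + x)) \o shift s) (h *: 1) - U (s *: v + x))) =
  (fun h => h^-1 *: ((U \o shift (s *: v + x)) (h *: v) - U (s *: v + x))).
Proof. by apply/funext => h /=; rewrite [_%:A]mulr1 scalerDl addrA. Qed.

Lemma derivable_line U x v s :
  derivable (fun r : R => U (r *: v + x)) s 1 = derivable U (s *: v + x) v.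
Proof. by rewrite /derivable growth_rate_line. Qed.

Lemma derive1_line U x v :
  derive1 (fun r : R => U (r *: v + x)) = (fun s => 'D_v U (s *: v + x)).
Proof.
by apply/funext => s; rewrite derive1E /derive growth_rate_line.
Qed.

End Directional.

Definition sqnorm n (x : 'rV[R]_n) : R := \sum_(j < n) x ord0 j ^+ 2.

Lemma sqnorm_ge0 n (x : 'rV[R]_n) : 0 <= sqnorm x.
Proof. by apply: sumr_ge0 => j _; exact: sqr_ge0. Qed.

Lemma sqnorm_line n (x : 'rV[R]_n) (j : 'I_n) (s : R) :
  sqnorm (s *: delta_mx ord0 j + x) = sqnorm x + (2 * s * x ord0 j + s ^+ 2).
Proof.
rewrite /sqnorm (bigD1 j)//= [in RHS](bigD1 j)//= !mxE !eqxx/= mulr1.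
rewrite (eq_bigr (fun i => x ord0 i ^+ 2)); first by ring.
by move=> i ij; rewrite !mxE (negbTE ij) andbF mulr0 add0r.
Qed.

Lemma continuous_sqnorm n : continuous (@sqnorm n).
Proof.
rewrite /sqnorm; apply: continuous_big => [|j _ x].
  exact: add_continuous.
apply: (@cvg_comp _ _ _ (fun y : 'rV[R]_n => y ord0 j) (fun z : R => z ^+ 2)).
  exact: coord_continuous.
exact: exprn_continuous.
Qed.

Lemma laplacian_at_perturbed_max n (G : set 'rV[R]_n) (U : 'rV[R]_n -> R)
    (e : R) (x : 'rV[R]_n) :
  open G -> Ck_on 2 G U -> G x ->
  (forall y, G y -> U y + e * sqnorm y <= U x + e * sqnorm x) ->
  laplacian U x <= - (2 * e) *+ n.
Proof.
move=> oG [_ /= U2] Gx Umax.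
rewrite -[n in leRHS]card_ord -sumr_const; apply: ler_sum => j _.
have [U1 [_ /(_ j)[U11 _]]] := U2 j.
set v : 'rV[R]_n := delta_mx ord0 j.
pose h (s : R) := U (s *: v + x).
have [r r0 hr] : exists2 r : R, 0 < r & forall s, s \in `]- r, r[ -> G (s *: v + x).
  have : \forall s \near (0 : R), G (s *: v + x).
    have : (fun s : R => s *: v + x) s @[s --> (0 : R)] --> x.
      rewrite -[X in _ --> X]add0r -[X in _ --> X + x](scale0r v).
      by apply: cvgD; [apply: cvgZr_tmp|exact: cvg_cst].
    by apply; exact: open_nbhs_nbhs.
  move=> /nbhs_ballP[r /= r0 hr]; exists r => // s sr; apply: hr.
  by rewrite /ball/= sub0r normrN ltr_norml; move: sr; rewrite in_itv.
have -> : partial j (partial j U) x = derive1 (derive1 h) 0.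
  by rewrite /h derive1_line (derive1_line ('D_v U)) scale0r add0r.
apply: (@second_derivative_at_perturbed_max h (x ord0 j) e r) => //.
- by move=> s sr; rewrite /h derivable_line; apply: U1; exact: hr.
- by rewrite /h derive1_line (derivable_line ('D_v U)) scale0r add0r; exact: U11.
- move=> s sr; have := Umax _ (hr _ sr).
  by rewrite sqnorm_line /h scale0r add0r mulrDr; lra.
Qed.

End Spatial.

(** * The maximum principle *)

Section MaximumPrinciple.
Context {R : realType}.

Lemma le_set_max (T : topologicalType) (D : set T) (f : T -> R) (p : T) :
  compact D -> {within D, continuous f} -> D p ->
  f p <= set_max [set f q | q in D].
Proof.
move=> cD cf Dp; have D0 : D !=set0 by exists p.
have [c cD' cmax] := compact_EVT_max D0 cD cf.
have [|_ ub] := @xgetPex _ 0 ([set f q | q in D] `&` ubound [set f q | q in D]).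
  exists (f c); split; first by exists c => //; exact: set_mem.
  by move=> _ [q Dq <-]; apply: cmax; exact: mem_set.
by apply: ub; exists p.
Qed.

Lemma bounded_set_closure n (G : set 'rV[R]_n) :
  bounded_set G -> bounded_set (closure G).
Proof.
move=> [M [Mreal GM]]; exists M; split=> // M' MM' x Gx.
have clM : closed [set y : 'rV[R]_n | `|y| <= M'].
  apply: (@closed_comp _ _ (fun y : 'rV[R]_n => `|y|) [set r | r <= M']).
    by move=> y _; exact: norm_continuous.
  exact: closed_le.
by apply: clM; apply: closure_subset Gx => y Gy; exact: GM.
Qed.

Lemma within_continuous_section n (D : set 'rV[R]_n) (E : set R)
    (u : 'rV[R]_n -> R -> R) (x : 'rV[R]_n) :
  {within D `*` E, continuous (fun p => u p.1 p.2)} -> D x ->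
  {within E, continuous (u x)}.
Proof.
move=> /subspace_continuousP cu Dx; apply/subspace_continuousP => s Es.
move=> A /(cu (x, s) (conj Dx Es))[[P Q] [/= xP sQ] PQA].
apply: filterS sQ => s' Qs' Es'.
by apply: (PQA (x, s')) => //; split=> //=; exact: nbhs_singleton.
Qed.

End MaximumPrinciple.

Theorem theorem4p2 (R : realType) (n : nat) (alpha nu T : R)
    (G : set 'rV[R]_n.+1) (F : 'rV[R]_n.+1 -> R -> R)
    (phi : 'rV[R]_n.+1 -> R) (psi : 'rV[R]_n.+1 -> R -> R)
    (u : 'rV[R]_n.+1 -> R -> R)
    (alpha_gt0 : 0 < alpha) (alpha_lt1 : alpha < 1)
    (nu_gt0 : 0 < nu) (T_gt1 : 1 < T)
    (G_domain : domain G) (G_bounded : bounded_set G)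
    (G_smooth : smooth_boundary G)
    (F_continuous :
      {within closure G `*` `[1, T], continuous (fun p => F p.1 p.2)})
    (phi_continuous : {within closure G, continuous phi})
    (psi_continuous :
      {within boundary G `*` `[1, T], continuous (fun p => psi p.1 p.2)})
    (u_continuous :
      {within closure G `*` `[1, T], continuous (fun p => u p.1 p.2)})
    (u_C2 : forall t, 1 < t <= T -> Ck_on 2 G (u ^~ t))
    (u_W12 : forall x, G x -> W12 1 T (u x))
    (u_cvg : forall x t, G x -> 1 < t <= T -> hadamard_cvg alpha T (u x) t)
    (u_equation : forall x t, G x -> 1 < t <= T ->
      hadamard_derive alpha T (u x) t = nu * laplacian (u ^~ t) x + F x t)
    (u_initial : forall x, closure G x -> u x 1 = phi x)
    (u_boundary : forall x t, boundary G x -> 1 <= t <= T -> u x t = psi x t)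
    (F_le0 : forall x t, closure G x -> 1 <= t <= T -> F x t <= 0) :
  forall x t, closure G x -> 1 <= t <= T ->
    u x t <= Num.max
      (set_max [set psi p.1 p.2 | p in boundary G `*` `[1, T]])
      (set_max [set phi y | y in closure G]).
Proof.
move=> x t Gx tT; set M := Num.max _ _.
have [_ oG _] := G_domain.
have compact_clG : compact (closure G).
  apply: bounded_closed_compact; last exact: closed_closure.
  exact: bounded_set_closure.
have compact_bdG : compact (boundary G).
  by apply: compact_closedI => //; apply: open_closedC; exact: open_interior.
have compactT : compact `[1, T] by exact: segment_compact.
have [B B0 hB] : exists2 B : R, 0 <= B & forall y, closure G y -> sqnorm y <= B.
  have [|c _ hc] := compact_EVT_max _ compact_clG
    (continuous_subspaceT (@continuous_sqnorm R n.+1)); first by exists x.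
  by exists (sqnorm c) => [|y Gy]; [exact: sqnorm_ge0|apply: hc; exact: mem_set].
apply/ler_addgt0Pr => eps eps0.
pose e := eps / (B + 1).
have e0 : 0 < e by rewrite divr_gt0// ltr_wpDl.
have eB : e * B <= eps.
  by rewrite /e mulrAC ler_pdivrMr ?ltr_wpDl// ler_pM2l// lerDl.
pose v (p : 'rV[R]_n.+1 * R) := u p.1 p.2 + e * sqnorm p.1.
have cv : {within closure G `*` `[1, T], continuous v}.
  have ce : continuous (fun p : 'rV[R]_n.+1 * R => e * sqnorm p.1).
    move=> q; apply: cvgM; first exact: cvg_cst.
    apply: (@cvg_comp _ _ _ fst (@sqnorm R n.+1)); first exact: cvg_fst.
    exact: continuous_sqnorm.
  move=> p; apply: cvgD; first exact: u_continuous.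
  exact: (continuous_subspaceT ce).
have Kxt : (closure G `*` `[1, T]) (x, t) by split=> //=; rewrite in_itv.
have [||[x0 t0] /set_mem[/= Gx0 t0T] vmax] := compact_EVT_max _ _ cv.
- by exists (x, t).
- exact: compact_setX.
have {}t0T : 1 <= t0 <= T by move: t0T; rewrite in_itv.
suff u0M : u x0 t0 <= M.
  have := vmax _ (mem_set Kxt); rewrite /v/= => h.
  have : 0 <= e * sqnorm x by rewrite mulr_ge0 ?sqnorm_ge0// ltW.
  have : e * sqnorm x0 <= e * B by rewrite ler_pM2l// hB.
  lra.
have [t01|t01] := eqVneq t0 1.
  by rewrite t01 u_initial// /M le_max (le_set_max compact_clG) ?orbT.
have [Gx0'|nGx0] := pselect (G x0); last first.
  have bx0 : boundary G x0 by split=> // /interior_subset.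
  have Kx0 : (boundary G `*` `[1, T]) (x0, t0) by split=> //=; rewrite in_itv.
  have := le_set_max (compact_setX compact_bdG compactT) psi_continuous Kx0.
  by rewrite /= -u_boundary// /M le_max => ->.
(* at an interior maximum after the initial time the equation fails *)
exfalso.
have {}t0T : 1 < t0 <= T.
  by move: t0T => /andP[t1 ->]; rewrite andbT lt_neqAle eq_sym t01.
have D0 : 0 <= hadamard_derive alpha T (u x0) t0.
  apply: hadamard_derive_ge0_at_max => //; first exact: ltW.
  - exact: within_continuous_section u_continuous Gx0.
  - exact: u_W12.
  - exact: u_cvg.
  - move=> s; rewrite in_itv/= => /andP[s1 st].
    have Ks : (closure G `*` `[1, T]) (x0, s).
      by split=> //=; rewrite in_itv/= s1 (le_trans st)//; case/andP: t0T.
    by have := vmax _ (mem_set Ks); rewrite /v/= lerD2r.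
have L0 : laplacian (u ^~ t0) x0 <= - (2 * e) *+ n.+1.
  apply: (laplacian_at_perturbed_max oG (u_C2 _ t0T) Gx0') => y Gy.
  have Ky : (closure G `*` `[1, T]) (y, t0).
    split=> /=; first exact: subset_closure.
    by rewrite in_itv/=; case/andP: t0T => /ltW-> ->.
  exact: vmax (mem_set Ky).
have F0 : F x0 t0 <= 0 by apply: F_le0 => //; case/andP: t0T => /ltW-> ->.
have : nu * laplacian (u ^~ t0) x0 < 0.
  rewrite pmulr_rlt0// (le_lt_trans L0)// mulNrn oppr_lt0 pmulrn_rgt0//.
  by rewrite mulr_gt0.
by move: D0; rewrite u_equation//; lra.
Qed.
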